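(* Assume $\phi:[0,1)\to\mathbb{R}^+$ is a twice continuously differentiable function such that $\Delta\phi>0$ and $(\Delta\phi(z))^{-1/2}\asymp\tau(z)$, where $\tau(z)$ is a radial positive differentiable function on the unit disc $\mathbb{D}$ that decreases to zero as $|z|\to1^-$ and satisfies $\lim_{r\to1^-}\tau'(r)=0$. Let $\omega=e^{-\phi}$. Then: (a) $\lim_{r\to1^-}(1-r)\phi'(r)=\infty$. (b) $\lim_{r\to1^-}\tau(r)\phi'(r)=\infty$, or, equivalently, $\lim_{r\to1^-}\frac{\phi''(r)}{(\phi'(r))^2}=0$. (c) $\psi_\omega(r)\asymp\frac1{\phi'(r)+1}$ for $r\in[0,1)$. (d) There exists $r_0\in[0,1)$ such that for all $a\in\mathbb{D}$ with $1>|a|>r_0$ and any $\delta>0$ small enough we have $$\phi'(a)\asymp\phi'(z),\quad z\in D(a,\delta\tau(a)).$$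
   Context: $\mathbb{D}$ is the open unit disc, and $D(a,r)$ is the Euclidean disc with center $a$ and radius $r$. $\phi$ is extended radially to $\mathbb{D}$ by $\phi(z)=\phi(|z|)$, with $\phi'(z)=\phi'(|z|)$ and $\Delta\phi(z)=\phi''(|z|)+\phi'(|z|)/|z|$ for $z\ne0$; similarly $\tau(z)=\tau(|z|)$. For a positive radial weight $\omega$, the distortion function is $\psi_\omega(r)=\frac1{\omega(r)}\int_r^1\omega(u)\,du$, $0\le r<1$. $E_1\asymp E_2$ means that there is a constant $k>0$ independent of the argument with $\frac1kE_1\le E_2\le kE_1$ (in (d) the constant is independent of $a$ and $z$). *)

(* Defs.v *)
(* Stdlib real numbers with Coquelicot. *)
From Stdlib Require Import Reals.
From Coquelicot Require Import Coquelicot.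
Open Scope R_scope.

Definition asymp_on {T : Type} (P : T -> Prop) (E1 E2 : T -> R) : Prop :=
  exists k : R, 0 < k /\ forall x : T, P x -> / k * E1 x <= E2 x <= k * E1 x.

Definition Ico01 (r : R) : Prop := 0 <= r < 1.

Definition unit_disc (z : C) : Prop := Cmod z < 1.

Definition open_disc (a : C) (r : R) (z : C) : Prop := Cmod (z - a)%C < r.

Definition radial (f : R -> R) (z : C) : R := f (Cmod z).

(* Derivative relative to [0,1): two-sided on (0,1), right derivative at 0.
   The values of [f] outside [0,1) are irrelevant. *)
Definition is_derive_Ico01 (f : R -> R) (r l : R) : Prop :=
  filterdiff f (within Ico01 (locally r)) (fun h : R => scal h l).

Definition C2_Ico01 (f f1 f2 : R -> R) : Prop :=
  (forall r, Ico01 r -> is_derive_Ico01 f r (f1 r)) /\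
  (forall r, Ico01 r -> is_derive_Ico01 f1 r (f2 r)) /\
  continuous_on Ico01 f2.

(* Laplacian, at [z <> 0], of the radial function with profile [f], where
   [f1] and [f2] are the first and second derivatives of [f]. *)
Definition radial_laplacian (f1 f2 : R -> R) (z : C) : R :=
  radial f2 z + radial f1 z / Cmod z.

(* Real (Frechet) differentiability at [z] of a function of a complex
   variable. *)
Definition R_differentiable (g : C -> R) (z : C) : Prop :=
  @ex_filterdiff R_AbsRing C_R_NormedModule R_NormedModule g (locally z).

(* The integral is improper at 1, since [omega] is only meaningful on [0,1). *)
Definition distortion (omega : R -> R) (r : R) : R :=
  / omega r * RInt_gen omega (at_point r) (at_left 1).

(* Main.v *)
(* Write [p = phi'] and [L = p' + p/r], so that [(r p)' = r L] and
   [c/tau^2 <= L <= C/tau^2].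
   (b) Near 1 we have [|tau'| <= eps], so [(1/tau)' <= eps/tau^2] is dominated by
   [(r p)'] and [r p] exceeds a multiple [const/eps] of [1/tau]; hence [tau p] tends
   to infinity, and [|p'|/p^2 <= C/(tau p)^2 + 1/(r p)] to 0.
   (a) [tau <= 1 - r] near 1.
   (c) Near 1, [- exp (- phi)/p] has a derivative comparable to [exp (- phi)]; away
   from 1 both sides are bounded above and below, since [phi] increases and [p] is
   bounded.
   (d) Over an interval of length [tau] the increasing function [r p] grows by at
   most a multiple of [1/tau], which is at most a multiple of [p]. *)
Require Import Defs.
From Stdlib Require Import Reals Lra Classical.
From Coquelicot Require Import Coquelicot.
Open Scope R_scope.

(** * Left neighbourhoods, derivatives relative to [0,1), mean value theorems *)

Lemma at_left_interval (b c : R) (P : R -> Prop) :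
  c < b -> at_left b P -> exists a, c <= a < b /\ forall x, a < x < b -> P x.
Proof.
intros hcb [d hd].
exists (Rmax c (b - d)); split.
- split; [apply Rmax_l | apply Rmax_lub_lt; [lra | generalize (cond_pos d); lra]].
- intros x [h1 h2]; apply hd; [|exact h2].
  generalize (Rmax_r c (b - d)); intros h.
  apply Rabs_lt_between'; lra.
Qed.

Lemma interval_at_left (a b : R) (P : R -> Prop) :
  a < b -> (forall x, a < x < b -> P x) -> at_left b P.
Proof.
intros hab h.
assert (hp : 0 < b - a) by lra.
exists (mkposreal _ hp); intros x hx hxb; apply h; split; [|exact hxb].
apply Rabs_lt_between' in hx; simpl in hx; lra.
Qed.

(** [Ico01] is a neighbourhood of every interior point, so there the restriction [within Ico01]
    changes nothing. *)
Lemma is_derive_Ico01_interior (f : R -> R) (r l : R) :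
  0 < r < 1 -> is_derive_Ico01 f r l -> is_derive f r l.
Proof.
intros hr [hlin hdom]; split; [exact hlin|].
intros x hx eps.
assert (hI : locally r Ico01).
{ assert (hd : 0 < Rmin r (1 - r)) by (apply Rmin_pos; lra).
  exists (mkposreal _ hd); intros y hy.
  apply Rabs_lt_between' in hy; simpl in hy.
  generalize (Rmin_l r (1 - r)) (Rmin_r r (1 - r)); intros.
  split; lra. }
assert (hx' : is_filter_lim (within Ico01 (locally r)) x).
{ intros P hP; apply filter_le_within, hx, hP. }
generalize (filter_and _ _ hI (hdom x hx' eps)).
apply filter_imp; intros y [h1 h2]; exact (h2 h1).
Qed.

Lemma is_derive_Ico01_continuous (f : R -> R) (r l : R) :
  is_derive_Ico01 f r l ->
  filterlim f (within Ico01 (locally r)) (locally (f r)).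
Proof.
intros h; apply (filterdiff_continuous_aux (K := R_AbsRing)
  (U := R_NormedModule) (V := R_NormedModule)).
- exists (fun h0 : R => scal h0 l); exact h.
- intros P hP; apply filter_le_within, hP.
Qed.

(* [Rmax 0] turns continuity relative to [0,1) into two-sided continuity, as
   the mean value theorem and the integrability lemmas require. *)
Lemma continuous_Rmax_Ico01 (f : R -> R) (x : R) :
  (forall r, Ico01 r -> filterlim f (within Ico01 (locally r)) (locally (f r))) ->
  x < 1 -> continuous (fun y => f (Rmax 0 y)) x.
Proof.
intros hf hx.
assert (hI : Ico01 (Rmax 0 x)) by (split; [apply Rmax_l | apply Rmax_lub_lt; lra]).
eapply filterlim_comp; [|exact (hf _ hI)].
intros P [d hd].
assert (hp : 0 < Rmin d (1 - x)) by (apply Rmin_pos; [apply cond_pos | lra]).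
exists (mkposreal _ hp); intros y hy.
apply Rabs_lt_between' in hy; simpl in hy.
generalize (Rmin_l d (1 - x)) (Rmin_r d (1 - x)); intros.
apply hd.
- apply Rabs_lt_between'; unfold Rmax; destruct (Rle_dec 0 y), (Rle_dec 0 x);
  generalize (cond_pos d); lra.
- split; [apply Rmax_l | apply Rmax_lub_lt; lra].
Qed.

Lemma MVT_open (f df : R -> R) (a b : R) :
  a < b -> (forall x, a <= x <= b -> continuous f x) ->
  (forall x, a < x < b -> is_derive f x (df x)) ->
  exists c, a < c < b /\ f b - f a = df c * (b - a).
Proof.
intros hab hc hd.
assert (pr : forall c, a < c < b -> derivable_pt f c).
{ intros c hcab; exists (df c); apply is_derive_Reals, hd, hcab. }
destruct (MVT f id a b pr (fun c _ => derivable_pt_id c) hab) as [c [P hcP]].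
- intros c hcab; apply continuity_pt_filterlim, hc, hcab.
- intros c _; apply derivable_continuous_pt, derivable_pt_id.
- exists c; split; [exact P|].
  rewrite derive_pt_id in hcP.
  rewrite (derive_pt_eq_0 f c (df c)) in hcP by apply is_derive_Reals, hd, P.
  unfold id in hcP; lra.
Qed.

Lemma derive_nonneg_le (f df : R -> R) (a b : R) :
  a <= b -> (forall x, a <= x <= b -> is_derive f x (df x)) ->
  (forall x, a <= x <= b -> 0 <= df x) -> f a <= f b.
Proof.
intros [hab | ->] hd hpos; [|lra].
destruct (MVT_open f df a b hab) as [c [hc heq]].
- intros x hx; apply (ex_derive_continuous f x); exists (df x); apply hd, hx.
- intros x hx; apply hd; lra.
- assert (0 <= df c * (b - a)) by (apply Rmult_le_pos; [apply hpos|]; lra); lra.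
Qed.

(** Compose with the real-linear embedding [RtoC]: for [x] near [r > 0] the modulus of [x] is [x],
    so the composite is [f]. *)
Lemma R_differentiable_radial_ex_derive (f : R -> R) (r : R) :
  0 < r -> R_differentiable (radial f) (RtoC r) -> ex_derive f r.
Proof.
intros hr [l hl].
assert (hi : filterdiff (U := R_NormedModule) (V := C_R_NormedModule)
  RtoC (locally r) RtoC).
{ apply filterdiff_linear; split.
  - intros x y; apply injective_projections; [reflexivity|].
    exact (eq_sym (Rplus_0_r 0)).
  - intros k x; apply injective_projections; [reflexivity|].
    exact (eq_sym (Rmult_0_r k)).
  - exists 1; split; [lra|]; intros x.
    change (sqrt (Rabs x ^ 2 + Rabs 0 ^ 2) <= 1 * Rabs x).
    rewrite Rabs_R0, pow_i, Rplus_0_r by auto with arith.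
    rewrite sqrt_pow2 by apply Rabs_pos; lra. }
apply (ex_derive_ext_loc (fun x => radial f (RtoC x))).
- exists (mkposreal _ hr); intros x hx.
  apply Rabs_lt_between' in hx; simpl in hx.
  unfold radial; rewrite Cmod_R, Rabs_pos_eq; [reflexivity | lra].
- apply ex_derive_filterdiff.
  exists (fun y => l (RtoC y)).
  exact (filterdiff_comp' _ _ _ _ _ hi hl).
Qed.

(** Extending [f] to the left of 0 by the constant [f 0] makes it continuous at 0 and leaves it
    unchanged near every positive point. *)
Lemma MVT_Ico01 (f df : R -> R) (a b : R) :
  (forall x, x < 1 -> continuous (fun y => f (Rmax 0 y)) x) ->
  0 <= a < b -> b < 1 -> (forall x, a < x < b -> is_derive f x (df x)) ->
  exists c, a < c < b /\ f b - f a = df c * (b - a).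
Proof.
intros hf hab hb hd.
destruct (MVT_open (fun y => f (Rmax 0 y)) df a b) as [c [hc heq]].
- lra.
- intros x hx; apply hf; lra.
- intros x hx; apply (is_derive_ext_loc f); [|apply hd, hx].
  assert (hx0 : 0 < x) by lra.
  exists (mkposreal _ hx0); intros y hy.
  apply Rabs_lt_between' in hy; simpl in hy.
  rewrite Rmax_right; [reflexivity | lra].
- exists c; split; [exact hc|].
  rewrite <- heq, !Rmax_right; lra.
Qed.

(** * Improper integrals and limits at the right endpoint *)

(** Partial integrals of a nonnegative function increase, so once bounded they converge to their
    supremum. The least-upper-bound form serves for bounding the improper integral from above and
    from below. *)
Lemma RInt_gen_at_left_lub (f : R -> R) (a b M : R) :
  a < b -> (forall x y, a <= x <= y -> y < b -> ex_RInt f x y) ->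
  (forall x, a <= x < b -> 0 <= f x) ->
  (forall x, a <= x < b -> RInt f a x <= M) ->
  is_lub (fun y => exists x, a <= x < b /\ y = RInt f a x)
    (RInt_gen f (at_point a) (at_left b)).
Proof.
intros hab hex hpos hM.
destruct (completeness (fun y => exists x, a <= x < b /\ y = RInt f a x))
  as [l hl].
- exists M; intros y [x [hx ->]]; apply hM, hx.
- exists (RInt f a a), a; split; [lra | reflexivity].
- replace (RInt_gen f (at_point a) (at_left b)) with l; [exact hl|].
  symmetry; apply is_RInt_gen_unique;
    try apply Proper_StrongProper; try typeclasses eauto.
  intros P [eps heps].
  (* Since [l] is the least upper bound, some partial integral exceeds l - eps; past [x0] all of
     them lie in (l - eps, l]. *)
  assert (hx0 : exists x, a <= x < b /\ l - eps < RInt f a x).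
  { destruct (classic (exists x, a <= x < b /\ l - eps < RInt f a x))
      as [h | h]; [exact h|exfalso].
    assert (l <= l - eps); [|generalize (cond_pos eps); lra].
    apply hl; intros y [x [hx ->]].
    destruct (Rle_lt_dec (RInt f a x) (l - eps)) as [h1|h1]; [exact h1|].
    contradict h; exists x; split; assumption. }
  destruct hx0 as [x0 [hx0 hlx0]].
  apply (Filter_prod _ _ _ (fun x => x = a) (fun x => x0 < x < b)).
  + reflexivity.
  + apply (interval_at_left x0); [lra | auto].
  + intros x y -> hy; simpl.
    exists (RInt f a y); split.
    * apply (RInt_correct (V := R_CompleteNormedModule)), hex; lra.
    * apply heps, Rabs_lt_between'; split.
      -- assert (heq : RInt f a x0 + RInt f x0 y = RInt f a y).
         { apply (RInt_Chasles (V := R_CompleteNormedModule)); apply hex; lra. }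
         assert (0 <= RInt f x0 y).
         { apply RInt_ge_0; [lra | apply hex; lra | intros; apply hpos; lra]. }
         lra.
      -- assert (RInt f a y <= l).
         { apply hl; exists y; split; [lra | reflexivity]. }
         generalize (cond_pos eps); lra.
Qed.

Lemma exp_le (x y : R) : x <= y -> exp x <= exp y.
Proof. intros [h | ->]; [left; apply exp_increasing, h | right; reflexivity]. Qed.

Lemma at_left_small (f : R -> R) (b eps : R) :
  filterlim f (at_left b) (locally 0) -> 0 < eps ->
  at_left b (fun r => Rabs (f r) < eps).
Proof.
intros hf heps.
assert (h : at_left b (fun r => ball 0 eps (f r)))
  by exact (hf _ (locally_ball 0 (mkposreal _ heps))).
revert h; apply filter_imp; intros r hr.
replace (f r) with (f r - 0) by ring; exact hr.
Qed.

(** * Radial estimates from two-sided bounds on the Laplacian *)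

Section RadialLaplacian.

(** In the application [c] and [C] are [/ k ^ 2] and [k ^ 2], where [k] is the constant comparing
    [tau] with the Laplacian. Within the section [C] is a real number, not the complex field. *)
Context {p p' tau : R -> R} {c C : R}.
Context (p_derive : forall r, 0 < r < 1 -> is_derive p r (p' r)).
Context (p_continuous : forall x, x < 1 -> continuous (fun y => p (Rmax 0 y)) x).
Context (tau_derive : forall r, 0 < r < 1 -> is_derive tau r (Derive tau r)).
Context (tau_pos : forall r, 0 < r < 1 -> 0 < tau r).
Context (tau_decr : forall r s, 0 <= r -> r <= s -> s < 1 -> tau s <= tau r).
Context (tau_lim : filterlim tau (at_left 1) (locally 0)).
Context (tau_derive_lim : filterlim (Derive tau) (at_left 1) (locally 0)).
Context (c_pos : 0 < c).
Context (laplacian_ge : forall r, 0 < r < 1 ->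
  c / tau r ^ 2 <= p' r + p r / r).
Context (laplacian_le : forall r, 0 < r < 1 ->
  p' r + p r / r <= C / tau r ^ 2).

Lemma is_derive_mult_id (r : R) : 0 < r < 1 ->
  is_derive (fun x => x * p x) r (r * (p' r + p r / r)).
Proof.
intros hr; generalize (p_derive r hr); intros hd.
auto_derive.
- exists (p' r); exact hd.
- rewrite (is_derive_unique _ _ _ hd : Derive (fun x => p x) r = p' r).
  field; lra.
Qed.

Lemma mult_id_continuous (x : R) : x < 1 ->
  continuous (fun y => Rmax 0 y * p (Rmax 0 y)) x.
Proof.
intros hx.
apply (continuous_mult (fun y => Rmax 0 y) (fun y => p (Rmax 0 y)));
  [|apply p_continuous, hx].
apply (continuous_Rmax_Ico01 id); [|exact hx].
intros y _ P hP; apply filter_le_within, hP.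
Qed.

Lemma laplacian_pos (r : R) : 0 < r < 1 -> 0 < p' r + p r / r.
Proof.
intros hr; apply Rlt_le_trans with (c / tau r ^ 2); [|apply laplacian_ge, hr].
apply Rdiv_lt_0_compat; [exact c_pos | apply pow_lt, tau_pos, hr].
Qed.

(** The function x p(x) vanishes at 0 and has positive derivative x L(x) on (0,1). *)
Lemma p_pos (r : R) : 0 < r < 1 -> 0 < p r.
Proof.
intros hr.
destruct (MVT_Ico01 (fun x => x * p x) (fun x => x * (p' x + p x / x)) 0 r)
  as [x [hx heq]]; try lra.
- exact mult_id_continuous.
- intros x hx; apply is_derive_mult_id; lra.
- apply Rmult_lt_reg_l with r; [lra|].
  assert (0 < x * (p' x + p x / x) * (r - 0)); [|lra].
  apply Rmult_lt_0_compat; [apply Rmult_lt_0_compat; [lra|] | lra].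
  apply laplacian_pos; lra.
Qed.

Lemma C_pos : 0 < C.
Proof.
assert (h : 0 < 1 / 2 < 1) by lra.
assert (0 < tau (1 / 2) ^ 2) by apply pow_lt, tau_pos, h.
assert (hcC : c / tau (1 / 2) ^ 2 <= C / tau (1 / 2) ^ 2).
{ eapply Rle_trans; [apply laplacian_ge, h | apply laplacian_le, h]. }
apply Rmult_le_reg_r in hcC; [lra | apply Rinv_0_lt_compat; assumption].
Qed.

(** * Decay of [tau] and growth of [p] near 1 *)

(** Since tau' tends to 0, the mean value theorem gives arbitrarily small Lipschitz constants near
    1. The bound [1 / 2 <= a] keeps later factors [x] away from 0. *)
Lemma tau_Lipschitz (eps : R) : 0 < eps ->
  exists a, 1 / 2 <= a < 1 /\
  (forall x, a < x < 1 -> Rabs (Derive tau x) < eps) /\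
  forall s t, a < s <= t -> t < 1 -> Rabs (tau t - tau s) <= eps * (t - s).
Proof.
intros heps.
destruct (at_left_interval 1 (1 / 2) _ ltac:(lra)
  (at_left_small _ 1 eps tau_derive_lim heps)) as [a [ha hd]].
exists a; split; [exact ha|]; split; [exact hd|].
intros s t hst ht.
destruct (proj2 hst) as [hlt | ->].
- destruct (MVT_open tau (Derive tau) s t hlt) as [x [hx ->]].
  + intros x hx; apply (ex_derive_continuous tau); exists (Derive tau x).
    apply tau_derive; lra.
  + intros x hx; apply tau_derive; lra.
  + rewrite Rabs_mult, (Rabs_pos_eq (t - s)) by lra.
    apply Rmult_le_compat_r; [lra | left; apply hd; lra].
- rewrite !Rminus_diag, Rabs_R0; lra.
Qed.

(** Let t tend to 1 in the 1-Lipschitz bound tau(r) - tau(t) <= t - r. *)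
Lemma tau_le_dist : at_left 1 (fun r => tau r <= 1 - r).
Proof.
destruct (tau_Lipschitz 1 Rlt_0_1) as [a [ha [_ hL]]].
apply (interval_at_left a); [lra|]; intros r hr.
apply Rnot_lt_le; intros hlt.
(* Were this excess positive, a point t close to 1 with tau(t) below it would violate the Lipschitz
   bound. *)
assert (heta : 0 < tau r - (1 - r)) by lra.
destruct (at_left_interval 1 r _ ltac:(lra)
  (at_left_small _ 1 _ tau_lim heta)) as [b [hb hs]].
assert (hm : b < (b + 1) / 2 < 1) by lra.
specialize (hs _ hm); apply Rabs_lt_between in hs.
specialize (hL r ((b + 1) / 2) ltac:(lra) ltac:(lra)).
apply Rabs_le_between in hL; lra.
Qed.

Lemma tau_p_lim :
  filterlim (fun r => tau r * p r) (at_left 1) (Rbar_locally p_infty).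
Proof.
intros P [M hM]; unfold filtermap.
(* The final lower bound for tau p is 2K/3; this [K] makes it exceed [M], whatever the sign of
   [M]. *)
pose (K := 4 * Rmax M 1).
assert (hK : 4 <= K) by (unfold K; generalize (Rmax_r M 1); lra).
assert (hKM : 4 * M <= K) by (unfold K; generalize (Rmax_l M 1); lra).
(* With |tau'| below this value, K |tau'| / tau^2 is at most c / (2 tau^2), which x L dominates
   because x >= 1/2. *)
assert (heps : 0 < c / (2 * K)) by (apply Rdiv_lt_0_compat; lra).
destruct (tau_Lipschitz _ heps) as [a [ha [hd _]]].
pose (b := (a + 1) / 2).
assert (hb : a < b < 1) by (unfold b; lra).
assert (htb : 0 < tau b) by (apply tau_pos; lra).
(* Past [b'] the ratio tau(r) / tau(b) is at most 1/3, so the term K / tau(b) costs at most a third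
   of K / tau(r). *)
destruct (at_left_interval 1 b _ ltac:(lra)
  (at_left_small _ 1 (tau b / 3) tau_lim ltac:(lra))) as [b' [hb' hsmall]].
apply (interval_at_left b'); [lra|]; intros r hr.
apply hM.
assert (htr : 0 < tau r) by (apply tau_pos; lra).
assert (hmono : b * p b - K / tau b <= r * p r - K / tau r).
{ apply (derive_nonneg_le (fun x => x * p x - K / tau x)
    (fun x => x * (p' x + p x / x) + K * Derive tau x / tau x ^ 2)).
  - lra.
  - intros x hx.
    assert (hx1 : 0 < x < 1) by lra.
    generalize (tau_pos x hx1) (tau_derive x hx1); intros htx hdx.
    replace (x * (p' x + p x / x) + K * Derive tau x / tau x ^ 2)
      with (minus (x * (p' x + p x / x)) (K * (- Derive tau x / tau x ^ 2)))
      by (unfold minus, plus, opp; simpl; field; lra).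
    apply (is_derive_minus (fun x => x * p x) (fun x => K / tau x)).
    + apply is_derive_mult_id, hx1.
    + apply (is_derive_scal (fun x => / tau x)), is_derive_inv; [exact hdx | lra].
  - intros x hx.
    assert (hx1 : 0 < x < 1) by lra.
    specialize (hd x ltac:(lra)); apply Rabs_lt_between in hd.
    generalize (laplacian_ge x hx1) (tau_pos x hx1); intros hL htx.
    assert (ht2 : 0 < / tau x ^ 2) by apply Rinv_0_lt_compat, pow_lt, htx.
    assert (h1 : 1 / 2 * (c / tau x ^ 2) <= x * (p' x + p x / x)).
    { apply Rmult_le_compat; try lra.
      apply Rlt_le, Rdiv_lt_0_compat; [lra | apply pow_lt, htx]. }
    assert (h2 : - (c / 2) * / tau x ^ 2 <= K * Derive tau x / tau x ^ 2).
    { apply Rmult_le_compat_r; [lra|].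
      replace (- (c / 2)) with (K * - (c / (2 * K))) by (field; lra).
      apply Rmult_le_compat_l; lra. }
    unfold Rdiv in *; lra. }
specialize (hsmall r hr); apply Rabs_lt_between in hsmall.
assert (hpb : 0 < b * p b) by (apply Rmult_lt_0_compat; [|apply p_pos]; lra).
assert (hpr : 0 < p r) by (apply p_pos; lra).
assert (h1 : tau r * (K / tau r - K / tau b) <= tau r * p r).
{ apply Rmult_le_compat_l; [lra|].
  assert (r * p r <= 1 * p r) by (apply Rmult_le_compat_r; lra); lra. }
assert (h2 : tau r / tau b <= 1 / 3).
{ apply Rle_div_l; lra. }
assert (h3 : tau r * (K / tau r - K / tau b) = K * (1 - tau r / tau b))
  by (field; lra).
assert (h4 : K * (2 / 3) <= K * (1 - tau r / tau b))
  by (apply Rmult_le_compat_l; lra).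
lra.
Qed.

(** Near 1 we have tau < 1, so [p] dominates tau p and is eventually as large. *)
Lemma tau_p_eventually (M : R) :
  at_left 1 (fun r => M < tau r * p r /\ M < p r).
Proof.
assert (h : at_left 1 (fun r => Rmax M 0 < tau r * p r)).
{ apply tau_p_lim; exists (Rmax M 0); auto. }
assert (h1 : at_left 1 (fun r => 0 < r < 1)).
{ apply (interval_at_left 0); [lra | auto]. }
generalize (filter_and _ _ h1 (filter_and _ _ h
  (at_left_small _ 1 1 tau_lim Rlt_0_1))).
apply filter_imp; intros r [hr [hM hs]].
apply Rabs_lt_between in hs.
generalize (Rmax_l M 0) (Rmax_r M 0) (p_pos r hr); intros.
assert (tau r * p r <= 1 * p r) by (apply Rmult_le_compat_r; lra).
lra.
Qed.

Lemma dist_p_lim :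
  filterlim (fun r => (1 - r) * p r) (at_left 1) (Rbar_locally p_infty).
Proof.
apply (filterlim_ge_p_infty (fun r => tau r * p r)); [|exact tau_p_lim].
assert (h1 : at_left 1 (fun r => 0 < r < 1)).
{ apply (interval_at_left 0); [lra | auto]. }
generalize (filter_and _ _ h1 tau_le_dist).
apply filter_imp; intros r [hr ht].
apply Rmult_le_compat_r; [left; apply p_pos, hr | exact ht].
Qed.

(** In p' = L - p/r both L and p/r are positive, so it is enough that each is below eps p^2. The
    product form avoids dividing by [p] and is reused for the tail integral. *)
Lemma p'_eventually_small (eps : R) : 0 < eps ->
  at_left 1 (fun r => Rabs (p' r) < eps * p r ^ 2).
Proof.
intros heps; generalize C_pos; intros hC.
assert (h1 : at_left 1 (fun r => 1 / 2 < r < 1)).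
{ apply (interval_at_left (1 / 2)); [lra | auto]. }
(* The numerator C + 2 covers both C, for the bound on L, and 2, for p/r <= 2p. The added 1 gives
   tau p >= 1, so that (tau p)^2 is at least X. *)
generalize (filter_and _ _ h1 (tau_p_eventually ((C + 2) / eps + 1))).
apply filter_imp; intros r [hr [h2 h3]].
assert (hr1 : 0 < r < 1) by lra.
set (X := (C + 2) / eps) in *.
assert (hX : eps * X = C + 2) by (unfold X; field; lra).
assert (hX0 : 0 < X) by (apply Rdiv_lt_0_compat; lra).
generalize (laplacian_le r hr1) (laplacian_ge r hr1) (tau_pos r hr1) (p_pos r hr1).
intros hu hl ht hp.
assert (hl0 : 0 < c / tau r ^ 2) by (apply Rdiv_lt_0_compat; [|apply pow_lt]; lra).
assert (hpr : p r / r <= 2 * p r).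
{ apply Rle_div_l; [lra|].
  assert (p r * 1 <= p r * (2 * r)) by (apply Rmult_le_compat_l; lra); lra. }
assert (hpr0 : 0 < p r / r) by (apply Rdiv_lt_0_compat; lra).
assert (hup : C / tau r ^ 2 < eps * p r ^ 2).
{ apply Rlt_div_l; [apply pow_lt, ht|].
  replace (eps * p r ^ 2 * tau r ^ 2) with (eps * ((tau r * p r) * (tau r * p r)))
    by ring.
  apply Rlt_le_trans with (eps * (X * 1)); [lra|].
  apply Rmult_le_compat_l; [lra|].
  apply Rmult_le_compat; lra. }
assert (hlow : 2 * p r < eps * p r ^ 2).
{ replace (eps * p r ^ 2) with ((eps * p r) * p r) by ring.
  apply Rmult_lt_compat_r; [exact hp|].
  apply Rlt_le_trans with (eps * X); [lra | apply Rmult_le_compat_l; lra]. }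
apply Rabs_lt_between; lra.
Qed.

Lemma p'_div_sqr_lim :
  filterlim (fun r => p' r / p r ^ 2) (at_left 1) (locally 0).
Proof.
intros P [eps heps]; unfold filtermap.
assert (h1 : at_left 1 (fun r => 0 < r < 1)).
{ apply (interval_at_left 0); [lra | auto]. }
generalize (filter_and _ _ h1 (p'_eventually_small eps (cond_pos eps))).
apply filter_imp; intros r [hr h].
apply heps; change (Rabs (p' r / p r ^ 2 - 0) < eps).
assert (hp : 0 < p r ^ 2) by apply pow_lt, p_pos, hr.
rewrite Rminus_0_r, Rabs_div, (Rabs_pos_eq (p r ^ 2)) by lra.
apply Rlt_div_l; assumption.
Qed.

(** * Comparison of values of [p] at nearby points and away from 1 *)

Lemma p_comparable :
  exists a K, 1 / 2 <= a < 1 /\ 0 < K /\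
  forall s t, a < s <= t -> t < 1 -> tau s <= 3 * tau t -> t - s <= tau t ->
  p t <= K * p s /\ p s <= K * p t.
Proof.
generalize C_pos; intros hC.
destruct (at_left_interval 1 (1 / 2) _ ltac:(lra) (tau_p_eventually 1))
  as [a [ha htp]].
(* The estimates below give p(s) <= 2 p(t) and p(t) <= (2 + 6C) p(s); this constant covers both. *)
exists a, (2 * (1 + 6 * C)); split; [exact ha|]; split; [lra|].
intros s t hs ht hst hd.
assert (hps : 0 < p s) by (apply p_pos; lra).
assert (hpt : 0 < p t) by (apply p_pos; lra).
assert (hts : 0 < tau s) by (apply tau_pos; lra).
assert (htt : 0 < tau t) by (apply tau_pos; lra).
destruct (htp s ltac:(lra)) as [hts1 _].
assert (hinc : s * p s <= t * p t).
{ apply (derive_nonneg_le (fun x => x * p x)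
    (fun x => x * (p' x + p x / x))); [lra| |].
  - intros x hx; apply is_derive_mult_id; lra.
  - intros x hx; apply Rmult_le_pos; [lra|].
    left; apply laplacian_pos; lra. }
assert (hup : C / tau t ^ 2 * s - s * p s <= C / tau t ^ 2 * t - t * p t).
{ apply (derive_nonneg_le (fun x => C / tau t ^ 2 * x - x * p x)
    (fun x => minus (C / tau t ^ 2 * 1) (x * (p' x + p x / x)))); [lra| |].
  - intros x hx.
    apply (is_derive_minus (fun x => C / tau t ^ 2 * x) (fun x => x * p x)).
    + apply (is_derive_scal (fun x => x)), (is_derive_id (K := R_AbsRing)).
    + apply is_derive_mult_id; lra.
  - intros x hx.
    (* As [tau] decreases, its least value on [s, t] is at [t]. *)
    assert (hL : p' x + p x / x <= C / tau t ^ 2).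
    { eapply Rle_trans; [apply laplacian_le; lra|].
      apply Rmult_le_compat_l; [lra|].
      apply Rinv_le_contravar; [apply pow_lt, htt|].
      apply pow_incr; split; [lra | apply tau_decr; lra]. }
    assert (hL0 : 0 < p' x + p x / x) by (apply laplacian_pos; lra).
    assert (x * (p' x + p x / x) <= 1 * (p' x + p x / x))
      by (apply Rmult_le_compat_r; lra).
    change (0 <= C / tau t ^ 2 * 1 - x * (p' x + p x / x)); lra. }
(* From 1 < tau(s) p(s) <= 3 tau(t) p(s) one gets 1 / tau(t) <= 3 p(s). *)
assert (h1 : C / tau t ^ 2 * (t - s) <= 3 * C * p s).
{ apply Rle_trans with (C / tau t ^ 2 * tau t).
  - apply Rmult_le_compat_l; [|exact hd].
    apply Rlt_le, Rdiv_lt_0_compat; [lra | apply pow_lt, htt].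
  - replace (C / tau t ^ 2 * tau t) with (C * / tau t) by (field; lra).
    rewrite (Rmult_comm 3 C), Rmult_assoc.
    apply Rmult_le_compat_l; [lra|].
    apply Rmult_le_reg_l with (tau t); [lra|].
    rewrite Rinv_r by lra.
    assert (tau s * p s <= 3 * tau t * p s) by (apply Rmult_le_compat_r; lra).
    lra. }
assert (h2 : 1 / 2 * p s <= s * p s) by (apply Rmult_le_compat_r; lra).
assert (h3 : s * p s <= 1 * p s) by (apply Rmult_le_compat_r; lra).
assert (h4 : 1 / 2 * p t <= t * p t) by (apply Rmult_le_compat_r; lra).
assert (h5 : t * p t <= 1 * p t) by (apply Rmult_le_compat_r; lra).
assert (0 < C * p s) by (apply Rmult_lt_0_compat; lra).
assert (0 < C * p t) by (apply Rmult_lt_0_compat; lra).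
lra.
Qed.

(** On (0, b] the derivative of x p(x) is at most C / tau(b)^2; integrating from 0 and dividing by
    [r] bounds [p]. *)
Lemma p_bounds (b : R) : 0 < b < 1 ->
  forall r, 0 <= r <= b -> 0 <= p r <= C / tau b ^ 2.
Proof.
intros hb; generalize C_pos; intros hC.
assert (htb : 0 < tau b ^ 2) by (apply pow_lt, tau_pos, hb).
assert (hM : 0 < C / tau b ^ 2) by (apply Rdiv_lt_0_compat; assumption).
assert (hpos : forall r, 0 < r <= b -> 0 <= p r <= C / tau b ^ 2).
{ intros r hr; split; [left; apply p_pos; lra|].
  destruct (MVT_Ico01 (fun x => x * p x) (fun x => x * (p' x + p x / x)) 0 r)
    as [x [hx heq]].
  - exact mult_id_continuous.
  - lra.
  - lra.
  - intros x hx; apply is_derive_mult_id; lra.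
  - assert (hL : x * (p' x + p x / x) <= 1 * (C / tau b ^ 2)).
    { apply Rmult_le_compat; [lra | | lra |].
      - left; apply laplacian_pos; lra.
      - eapply Rle_trans; [apply laplacian_le; lra|].
        apply Rmult_le_compat_l; [lra|].
        apply Rinv_le_contravar; [exact htb|].
        apply pow_incr; split; [apply Rlt_le, tau_pos; lra | apply tau_decr; lra]. }
    apply Rmult_le_reg_l with r; [lra|].
    assert (x * (p' x + p x / x) * r <= 1 * (C / tau b ^ 2) * r)
      by (apply Rmult_le_compat_r; lra).
    lra. }
intros r [[hr | <-] hrb]; [apply hpos; lra|].
(* The Laplacian bounds say nothing at 0, so both inequalities pass to [p 0] by right continuity. *)
assert (hlim : filterlim (fun y => p (Rmax 0 y)) (at_right 0) (locally (p 0))).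
{ apply (filterlim_filter_le_1 (F := locally 0)); [apply filter_le_within|].
  replace (p 0) with (p (Rmax 0 0)) by (rewrite Rmax_left; [reflexivity | lra]).
  apply p_continuous; lra. }
assert (hev : at_right 0 (fun y => 0 <= p (Rmax 0 y) <= C / tau b ^ 2)).
{ exists (mkposreal _ (proj1 hb)); intros y hy hy0.
  apply Rabs_lt_between' in hy; simpl in hy.
  rewrite Rmax_right by lra; apply hpos; lra. }
split.
- apply (filterlim_le (F := at_right 0) (fun _ => 0) (fun y => p (Rmax 0 y))
    (Finite 0) (Finite (p 0))); [|apply filterlim_const | exact hlim].
  revert hev; apply filter_imp; tauto.
- apply (filterlim_le (F := at_right 0) (fun y => p (Rmax 0 y))
    (fun _ => C / tau b ^ 2) (Finite (p 0)) (Finite (C / tau b ^ 2)));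
    [|exact hlim | apply filterlim_const].
  revert hev; apply filter_imp; tauto.
Qed.

(** * The weight exp(-phi), its tail integral and the distortion function *)

Context {phi : R -> R}.
Context (phi_nonneg : forall r, Ico01 r -> 0 <= phi r).
Context (phi_continuous : forall x, x < 1 ->
  continuous (fun y => phi (Rmax 0 y)) x).
Context (phi_derive : forall r, 0 < r < 1 -> is_derive phi r (p r)).

Let omega (u : R) : R := exp (- phi u).

Lemma phi_incr (r s : R) : 0 <= r <= s -> s < 1 -> phi r <= phi s.
Proof.
intros [hr [hrs | ->]] hs; [|lra].
destruct (MVT_Ico01 phi p r s) as [x [hx heq]]; try lra; auto.
- intros x hx; apply phi_derive; lra.
- assert (0 < p x * (s - r)) by (apply Rmult_lt_0_compat; [apply p_pos|]; lra).
  lra.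
Qed.

Lemma omega_decr (r s : R) : 0 <= r <= s -> s < 1 -> omega s <= omega r.
Proof.
intros hr hs; apply exp_le, Ropp_le_contravar, phi_incr; assumption.
Qed.

Lemma omega_le_1 (r : R) : 0 <= r < 1 -> omega r <= 1.
Proof.
intros hr; rewrite <- exp_0; apply exp_le; generalize (phi_nonneg r hr); lra.
Qed.

(** At [r = 0] only right continuity of [phi] is known, so the integrand is first replaced by its
    constant extension to the left. *)
Lemma ex_RInt_omega (r s : R) : 0 <= r <= s -> s < 1 -> ex_RInt omega r s.
Proof.
intros hr hs.
apply (ex_RInt_ext (fun y => exp (- phi (Rmax 0 y)))).
- intros x hx; rewrite Rmin_left, Rmax_right in hx by lra.
  unfold omega; rewrite Rmax_right; [reflexivity | lra].
- apply (ex_RInt_continuous (V := R_CompleteNormedModule)); intros x hx.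
  rewrite Rmin_left, Rmax_right in hx by lra.
  apply continuous_exp_comp, (continuous_opp (fun y => phi (Rmax 0 y))).
  apply phi_continuous; lra.
Qed.

(** As [omega] decreases, every partial integral is at most (x - r) omega(r) <= omega(r). *)
Lemma tail_lub (r : R) : 0 <= r < 1 ->
  is_lub (fun y => exists x, r <= x < 1 /\ y = RInt omega r x)
    (RInt_gen omega (at_point r) (at_left 1)).
Proof.
intros hr; apply RInt_gen_at_left_lub with (omega r).
- lra.
- intros x y hx hy; apply ex_RInt_omega; lra.
- intros x hx; left; apply exp_pos.
- intros x hx.
  apply Rle_trans with (RInt (fun _ => omega r) r x).
  + apply RInt_le; [lra | apply ex_RInt_omega; lra | apply ex_RInt_const |].
    intros y hy; apply omega_decr; lra.
  + rewrite RInt_const; unfold scal; simpl; unfold mult; simpl.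
    assert (0 < omega r) by apply exp_pos.
    assert ((x - r) * omega r <= 1 * omega r) by (apply Rmult_le_compat_r; lra).
    lra.
Qed.

(* The derivative of [- omega/p] is [omega (1 + p'/p^2)], and [|p'/p^2| <= 1/2]
   near 1. *)
Lemma tail_asymp : exists a, 1 / 2 <= a < 1 /\ forall r, a < r < 1 ->
  1 <= p r /\
  1 / 3 * (omega r / p r) <= RInt_gen omega (at_point r) (at_left 1)
    <= 2 * (omega r / p r).
Proof.
destruct (at_left_interval 1 (1 / 2) _ ltac:(lra)
  (filter_and _ _ (tau_p_eventually 1) (p'_eventually_small (1 / 2) ltac:(lra))))
  as [a [ha h]].
exists a; split; [exact ha|]; intros r hr.
split; [left; apply (h r hr)|].
assert (hG : forall x, r <= x < 1 ->
  is_derive (fun x => omega x / p x) x (- omega x - omega x * (p' x / p x ^ 2))).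
{ intros x hx; assert (hx1 : 0 < x < 1) by lra.
  generalize (p_pos x hx1) (p_derive x hx1) (phi_derive x hx1); intros hp dp dphi.
  unfold omega; auto_derive.
  - repeat split; [exists (p x); exact dphi | exists (p' x); exact dp | lra].
  - rewrite (is_derive_unique _ _ _ dp : Derive (fun x => p x) x = p' x).
    rewrite (is_derive_unique _ _ _ dphi : Derive (fun x => phi x) x = p x).
    field; lra. }
assert (hF : forall x, r <= x < 1 -> is_derive (fun x => RInt omega r x) x (omega x)).
{ intros x hx; apply (is_derive_RInt omega (fun x => RInt omega r x) r x).
  - assert (hd : 0 < Rmin x (1 - x)) by (apply Rmin_pos; lra).
    exists (mkposreal _ hd); intros y hy.
    apply Rabs_lt_between' in hy; simpl in hy.
    generalize (Rmin_l x (1 - x)) (Rmin_r x (1 - x)); intros.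
    apply (RInt_correct (V := R_CompleteNormedModule)).
    destruct (Rle_lt_dec r y) as [hry | hry].
    + apply ex_RInt_omega; lra.
    + apply ex_RInt_swap, ex_RInt_omega; lra.
  - apply continuous_exp_comp, (continuous_opp phi).
    apply (ex_derive_continuous phi); exists (p x); apply phi_derive; lra. }
assert (hq : forall x, r <= x < 1 ->
  - (omega x / 2) <= omega x * (p' x / p x ^ 2) <= omega x / 2).
{ intros x hx; destruct (h x ltac:(lra)) as [_ hs].
  assert (hp : 0 < p x ^ 2) by (apply pow_lt, p_pos; lra).
  assert (ho : 0 < omega x) by apply exp_pos.
  apply Rabs_lt_between in hs.
  assert (- (1 / 2) <= p' x / p x ^ 2 <= 1 / 2).
  { split; [apply Rle_div_r | apply Rle_div_l]; lra. }
  split.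
  - replace (- (omega x / 2)) with (omega x * - (1 / 2)) by field.
    apply Rmult_le_compat_l; lra.
  - replace (omega x / 2) with (omega x * (1 / 2)) by field.
    apply Rmult_le_compat_l; lra. }
(* With q = p'/p^2 >= -1/2, the derivative 2 omega (1 + q) - omega is nonnegative. *)
assert (hup : forall x, r <= x < 1 -> RInt omega r x <= 2 * (omega r / p r)).
{ intros x hx.
  assert (hm : -2 * (omega r / p r) - RInt omega r r
    <= -2 * (omega x / p x) - RInt omega r x).
  { apply (derive_nonneg_le (fun x => -2 * (omega x / p x) - RInt omega r x)
      (fun x => -2 * (- omega x - omega x * (p' x / p x ^ 2)) - omega x));
      [lra| |].
    - intros y hy.
      apply (is_derive_minus (fun y => -2 * (omega y / p y)) (fun y => RInt omega r y)).
      + apply (is_derive_scal (fun y => omega y / p y)), hG; lra.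
      + apply hF; lra.
    - intros y hy; specialize (hq y ltac:(lra)); lra. }
  rewrite RInt_point in hm; change (zero : R) with 0 in hm.
  assert (0 < omega x / p x)
    by (apply Rdiv_lt_0_compat; [apply exp_pos | apply p_pos; lra]).
  lra. }
(* With q <= 1/2, the derivative omega - (2/3) omega (1 + q) is nonnegative. *)
assert (hlow : forall x, r <= x < 1 ->
  2 / 3 * (omega r / p r - omega x / p x) <= RInt omega r x).
{ intros x hx.
  assert (hm : 2 / 3 * (omega r / p r) + RInt omega r r
    <= 2 / 3 * (omega x / p x) + RInt omega r x).
  { apply (derive_nonneg_le (fun x => 2 / 3 * (omega x / p x) + RInt omega r x)
      (fun x => 2 / 3 * (- omega x - omega x * (p' x / p x ^ 2)) + omega x));
      [lra| |].
    - intros y hy.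
      apply (is_derive_plus (fun y => 2 / 3 * (omega y / p y))
        (fun y => RInt omega r y)).
      + apply (is_derive_scal (fun y => omega y / p y)), hG; lra.
      + apply hF; lra.
    - intros y hy; specialize (hq y ltac:(lra)); lra. }
  rewrite RInt_point in hm; change (zero : R) with 0 in hm; lra. }
destruct (tail_lub r ltac:(lra)) as [hub hlub].
split.
- assert (hG0 : 0 < omega r / p r)
    by (apply Rdiv_lt_0_compat; [apply exp_pos | apply p_pos; lra]).
  (* Since omega <= 1 and [p] is unbounded, some [x] makes omega(x)/p(x) at most half of
     omega(r)/p(r); then 2/3 becomes 1/3. *)
  destruct (at_left_interval 1 r _ ltac:(lra)
    (tau_p_eventually (2 / (omega r / p r)))) as [b [hb hpb]].
  pose (x := (b + 1) / 2).
  assert (hx : b < x < 1) by (unfold x; lra).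
  destruct (hpb x hx) as [_ hpx].
  assert (hpx0 : 0 < p x) by (apply p_pos; lra).
  assert (hGx : omega x / p x <= omega r / p r / 2).
  { apply Rle_div_l; [exact hpx0|].
    apply Rle_trans with 1; [apply omega_le_1; lra|].
    apply Rlt_div_l in hpx; lra. }
  apply Rle_trans with (RInt omega r x).
  + specialize (hlow x ltac:(lra)); lra.
  + apply hub; exists x; split; [lra | reflexivity].
- apply hlub; intros y [x [hx ->]]; apply hup, hx.
Qed.

Lemma distortion_bounds : exists m M, 0 < m /\ 0 < M /\
  forall r, Ico01 r -> m <= distortion omega r * (p r + 1) <= M.
Proof.
destruct tail_asymp as [a [ha htail]].
pose (b := (a + 1) / 2).
assert (hb : a < b < 1) by (unfold b; lra).
assert (homega : forall r, 0 < omega r) by (intros r; apply exp_pos).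
destruct (htail b hb) as [hpb [hIb _]].
set (m := omega b / p b) in *.
assert (hm : 0 < m) by (apply Rdiv_lt_0_compat; [apply homega | lra]).
pose (B := C / tau b ^ 2).
assert (hB : 0 < B).
{ apply Rdiv_lt_0_compat; [exact C_pos | apply pow_lt, tau_pos; lra]. }
assert (hm1 : 0 < Rmin (1 / 3) (m / 3)) by (apply Rmin_pos; lra).
(* Let psi be the distortion. For r <= b, m/3 <= psi <= 1 and 0 <= p <= B. For r > b, 1/3 <= psi p
   <= 2 and p >= 1, so psi (p + 1) <= 4. *)
exists (Rmin (1 / 3) (m / 3)), (4 + B); split; [exact hm1|]; split; [lra|].
intros r hr; unfold Ico01 in hr; unfold distortion.
generalize (Rmin_l (1 / 3) (m / 3)) (Rmin_r (1 / 3) (m / 3)).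
set (I := RInt_gen omega (at_point r) (at_left 1)); intros hl1 hl2.
specialize (homega r).
assert (hrange : forall l u, l * omega r <= I <= u * omega r -> l <= / omega r * I <= u).
{ intros l u hI; rewrite Rmult_comm.
  split; [apply Rle_div_r | apply Rle_div_l]; lra. }
destruct (Rle_lt_dec r b) as [hrb | hrb].
- assert (hp : 0 <= p r <= B) by (apply p_bounds; lra).
  assert (hI : m / 3 <= / omega r * I <= 1).
  { apply hrange; split.
    - apply Rle_trans with (m / 3 * 1).
      + apply Rmult_le_compat_l; [lra | apply omega_le_1, hr].
      + apply Rle_trans with (RInt_gen omega (at_point b) (at_left 1)); [lra|].
        apply (tail_lub b ltac:(lra)); intros y [x [hx ->]].
        apply Rle_trans with (RInt omega r x).
        * assert (heq : RInt omega r b + RInt omega b x = RInt omega r x).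
          { apply (RInt_Chasles (V := R_CompleteNormedModule));
              apply ex_RInt_omega; lra. }
          assert (0 <= RInt omega r b); [|lra].
          apply RInt_ge_0; [lra | apply ex_RInt_omega; lra|].
          intros z _; left; apply exp_pos.
        * apply (tail_lub r ltac:(lra)); exists x; split; [lra | reflexivity].
    - apply (tail_lub r ltac:(lra)); intros y [x [hx ->]].
      rewrite Rmult_1_l.
      apply Rle_trans with (RInt (fun _ => omega r) r x).
      + apply RInt_le; [lra | apply ex_RInt_omega; lra | apply ex_RInt_const |].
        intros z hz; apply omega_decr; lra.
      + rewrite RInt_const; change ((x - r) * omega r <= omega r).
        assert ((x - r) * omega r <= 1 * omega r) by (apply Rmult_le_compat_r; lra).
        lra. }
  set (J := / omega r * I) in *; clearbody J.
  assert (J * 1 <= J * (p r + 1)) by (apply Rmult_le_compat_l; lra).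
  assert (J * (p r + 1) <= 1 * (p r + 1)) by (apply Rmult_le_compat_r; lra).
  lra.
- destruct (htail r ltac:(lra)) as [hp hI].
  assert (hJ : 1 / 3 / p r <= / omega r * I <= 2 / p r).
  { apply hrange; unfold I, Rdiv in *; lra. }
  set (J := / omega r * I) in *; clearbody J.
  assert (h1 : 1 / 3 <= J * p r) by (apply (Rle_div_l (1 / 3)); lra).
  assert (h2 : J * p r <= 2) by (apply (Rle_div_r J 2); lra).
  assert (hJ0 : 0 < J) by (apply Rlt_le_trans with (1 / 3 / p r);
    [apply Rdiv_lt_0_compat; lra | lra]).
  assert (J * 1 <= J * p r) by (apply Rmult_le_compat_l; lra).
  lra.
Qed.

End RadialLaplacian.

(** * Transfer to the unit disc *)

Lemma Cmod_triangle_rev (a z : C) : Rabs (Cmod z - Cmod a) <= Cmod (z - a).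
Proof.
apply Rabs_le_between.
assert (h1 : Cmod z <= Cmod (z - a) + Cmod a).
{ replace z with ((z - a) + a)%C at 1 by ring; apply Cmod_triangle. }
assert (h2 : Cmod a <= Cmod z + Cmod (z - a)).
{ replace a with (z + - (z - a))%C at 1 by ring.
  rewrite <- (Cmod_opp (z - a)); apply Cmod_triangle. }
lra.
Qed.

(** The hypotheses on the disc are evaluated at real points to obtain the one-variable bounds. In
    (d) the discs are also shown to stay in the unit disc, where [phi1] is meaningful. *)
Theorem lemma32 (phi phi1 phi2 tau : R -> R)
  (phi_nonneg : forall r, Ico01 r -> 0 <= phi r)
  (phi_C2 : C2_Ico01 phi phi1 phi2)
  (laplacian_pos : forall z : C, unit_disc z -> z <> 0%C ->
     0 < radial_laplacian phi1 phi2 z)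
  (laplacian_tau : asymp_on (fun z : C => unit_disc z /\ z <> 0%C)
     (fun z => / sqrt (radial_laplacian phi1 phi2 z)) (radial tau))
  (tau_pos : forall z : C, unit_disc z -> 0 < radial tau z)
  (tau_diff : forall z : C, unit_disc z -> R_differentiable (radial tau) z)
  (tau_decr : forall r s, 0 <= r -> r <= s -> s < 1 -> tau s <= tau r)
  (tau_lim : filterlim tau (at_left 1) (locally 0))
  (tau_derive_lim : filterlim (Derive tau) (at_left 1) (locally 0)) :

  filterlim (fun r => (1 - r) * phi1 r) (at_left 1) (Rbar_locally p_infty) /\

  (filterlim (fun r => tau r * phi1 r) (at_left 1) (Rbar_locally p_infty) /\
   filterlim (fun r => phi2 r / phi1 r ^ 2) (at_left 1) (locally 0)) /\

  asymp_on Ico01 (distortion (fun u => exp (- phi u))) (fun r => / (phi1 r + 1)) /\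

  (exists r0 : R, Ico01 r0 /\
   exists delta0 : R, 0 < delta0 /\
   forall delta : R, 0 < delta < delta0 ->
     (forall a : C, r0 < Cmod a < 1 -> forall z : C,
        open_disc a (delta * radial tau a) z -> unit_disc z) /\
     asymp_on
       (fun az : C * C =>
          r0 < Cmod (fst az) < 1 /\
          open_disc (fst az) (delta * radial tau (fst az)) (snd az))
       (fun az => radial phi1 (fst az))
       (fun az => radial phi1 (snd az))).
Proof.
destruct phi_C2 as [dphi [dphi1 _]].
assert (hphi : forall r, 0 < r < 1 -> is_derive phi r (phi1 r)).
{ intros r hr; apply is_derive_Ico01_interior; [exact hr | apply dphi; split; lra]. }
assert (hp : forall r, 0 < r < 1 -> is_derive phi1 r (phi2 r)).
{ intros r hr; apply is_derive_Ico01_interior; [exact hr | apply dphi1; split; lra]. }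
assert (phi_cont : forall x, x < 1 -> continuous (fun y => phi (Rmax 0 y)) x).
{ intros x; apply continuous_Rmax_Ico01.
  intros r hr; apply (is_derive_Ico01_continuous _ _ (phi1 r)), dphi, hr. }
assert (p_cont : forall x, x < 1 -> continuous (fun y => phi1 (Rmax 0 y)) x).
{ intros x; apply continuous_Rmax_Ico01.
  intros r hr; apply (is_derive_Ico01_continuous _ _ (phi2 r)), dphi1, hr. }
assert (hCmod : forall r, 0 < r -> Cmod (RtoC r) = r).
{ intros r hr; rewrite Cmod_R; apply Rabs_pos_eq; lra. }
assert (hdisc : forall r, 0 < r < 1 -> unit_disc (RtoC r) /\ RtoC r <> 0%C).
{ intros r hr; split.
  - unfold unit_disc; rewrite hCmod; lra.
  - apply Cmod_gt_0; rewrite hCmod; lra. }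
assert (ht : forall r, 0 < r < 1 -> 0 < tau r).
{ intros r hr; destruct (hdisc r hr) as [h _].
  generalize (tau_pos _ h); unfold radial; rewrite hCmod; lra. }
assert (hdt : forall r, 0 < r < 1 -> is_derive tau r (Derive tau r)).
{ intros r hr; apply Derive_correct, R_differentiable_radial_ex_derive; [lra|].
  apply tau_diff, hdisc, hr. }
destruct laplacian_tau as [k [hk hlap]].
(* Squaring 1 <= k tau sqrt(L) and tau sqrt(L) <= k. *)
assert (hL : forall r, 0 < r < 1 ->
  / k ^ 2 / tau r ^ 2 <= phi2 r + phi1 r / r /\
  phi2 r + phi1 r / r <= k ^ 2 / tau r ^ 2).
{ intros r hr; destruct (hdisc r hr) as [h1 h2].
  generalize (laplacian_pos _ h1 h2) (hlap _ (conj h1 h2)) (ht r hr).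
  unfold radial_laplacian, radial; rewrite hCmod by lra.
  set (L := phi2 r + phi1 r / r); intros hL0 [hl hu] htr.
  assert (hs : 0 < sqrt L) by apply sqrt_lt_R0, hL0.
  assert (hs2 : sqrt L ^ 2 = L) by (apply pow2_sqrt; lra).
  assert (hl' : 1 <= k * tau r * sqrt L).
  { apply Rmult_le_compat_l with (r := k * sqrt L) in hl;
      [|apply Rmult_le_pos; lra].
    replace (k * sqrt L * (/ k * / sqrt L)) with 1 in hl by (field; lra).
    lra. }
  assert (hu' : tau r * sqrt L <= k).
  { apply Rmult_le_compat_r with (r := sqrt L) in hu; [|lra].
    replace (k * / sqrt L * sqrt L) with k in hu by (field; lra).
    exact hu. }
  assert (ht2 : 0 < tau r ^ 2) by apply pow_lt, htr.
  assert (hk2 : 0 < k ^ 2) by apply pow_lt, hk.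
  rewrite <- hs2; split.
  - apply (Rle_div_l (/ k ^ 2)); [exact ht2|].
    apply Rmult_le_reg_l with (k ^ 2); [exact hk2|].
    rewrite Rinv_r by lra.
    replace (k ^ 2 * (sqrt L ^ 2 * tau r ^ 2)) with ((k * tau r * sqrt L) ^ 2) by ring.
    rewrite <- (pow1 2); apply pow_incr; lra.
  - apply (Rle_div_r (sqrt L ^ 2)); [exact ht2|].
    rewrite Rmult_comm, <- Rpow_mult_distr.
    apply pow_incr; split; [apply Rmult_le_pos; lra | exact hu']. }
assert (hc : 0 < / k ^ 2) by apply Rinv_0_lt_compat, pow_lt, hk.
assert (hge : forall r, 0 < r < 1 -> / k ^ 2 / tau r ^ 2 <= phi2 r + phi1 r / r)
  by (intros r hr; apply hL, hr).
assert (hle : forall r, 0 < r < 1 -> phi2 r + phi1 r / r <= k ^ 2 / tau r ^ 2)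
  by (intros r hr; apply hL, hr).
split; [|split; [split|split]].
- exact (dist_p_lim hp p_cont hdt ht tau_lim tau_derive_lim hc hge).
- exact (tau_p_lim hp p_cont hdt ht tau_lim tau_derive_lim hc hge).
- exact (p'_div_sqr_lim hp p_cont hdt ht tau_lim tau_derive_lim hc hge hle).
- destruct (distortion_bounds hp p_cont hdt ht tau_decr tau_lim tau_derive_lim
    hc hge hle phi_nonneg phi_cont hphi) as [m [M [hm [hM hb]]]].
  assert (hm' : 0 < / m) by apply Rinv_0_lt_compat, hm.
  exists (/ m + M); split; [lra|]; intros r hr.
  (* The case r = 0 is included, hence [p_bounds] on [0, (r + 1)/2] instead of [p_pos]. *)
  assert (hp0 : 0 <= phi1 r).
  { destruct hr as [hr0 hr1].
    assert (hrb : 0 < (r + 1) / 2 < 1) by lra.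
    refine (proj1 (p_bounds hp p_cont ht tau_decr hc hge hle _ hrb r _)); lra. }
  specialize (hb r hr); revert hb.
  set (psi := distortion _ r); intros [hb1 hb2].
  assert (hpsi : 0 < psi).
  { apply Rmult_lt_reg_r with (phi1 r + 1); lra. }
  assert (hinv : psi * (phi1 r + 1) * / (phi1 r + 1) = psi) by (field; lra).
  assert (hs : 0 < / (phi1 r + 1)) by (apply Rinv_0_lt_compat; lra).
  split.
  + apply Rmult_le_reg_l with (/ m + M); [lra|].
    rewrite <- Rmult_assoc, Rinv_r, Rmult_1_l by lra.
    rewrite <- hinv at 1; apply Rmult_le_compat_r; lra.
  + apply Rle_trans with (/ m * psi); [|apply Rmult_le_compat_r; lra].
    rewrite <- hinv, <- Rmult_assoc, <- (Rmult_1_l (/ (phi1 r + 1))) at 1.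
    apply Rmult_le_compat_r; [lra|].
    apply Rmult_le_reg_l with m; [exact hm|].
    rewrite <- Rmult_assoc, Rinv_r; lra.
- destruct (p_comparable hp p_cont hdt ht tau_decr tau_lim tau_derive_lim
    hc hge hle) as [a1 [K [ha1 [hK hcomp]]]].
  destruct (tau_Lipschitz hdt tau_derive_lim 1 Rlt_0_1) as [a2 [ha2 [_ hlip]]].
  destruct (at_left_interval 1 (1 / 2) _ ltac:(lra)
    (tau_le_dist hdt tau_lim tau_derive_lim)) as [a3 [ha3 hdist]].
  pose (b := Rmax a1 (Rmax a2 a3)).
  assert (hb : a1 <= b /\ a2 <= b /\ a3 <= b /\ b < 1).
  { unfold b; generalize (Rmax_l a1 (Rmax a2 a3)) (Rmax_r a1 (Rmax a2 a3))
      (Rmax_l a2 a3) (Rmax_r a2 a3); intros.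
    repeat split; try lra; repeat apply Rmax_lub_lt; lra. }
  (* For |a| beyond this radius, |a| - (1 - |a|)/2 > b. As delta < 1/2 and tau(a) <= 1 - |a|, the
     modulus of [z] then stays between [b] and 1. *)
  exists ((1 + 2 * b) / 3); split; [unfold Ico01; lra|].
  exists (1 / 2); split; [lra|]; intros delta hdelta.
  assert (hnear : forall a z : C, (1 + 2 * b) / 3 < Cmod a < 1 ->
    open_disc a (delta * radial tau a) z ->
    b < Cmod z < 1 /\ Rabs (Cmod z - Cmod a) <= tau (Cmod a) / 2).
  { intros a z ha hz; unfold open_disc, radial in hz.
    generalize (Cmod_triangle_rev a z) (hdist (Cmod a) ltac:(lra))
      (ht (Cmod a) ltac:(lra)); intros h1 h2 h3.
    assert (h4 : delta * tau (Cmod a) <= 1 / 2 * tau (Cmod a))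
      by (apply Rmult_le_compat_r; lra).
    assert (h5 : Rabs (Cmod z - Cmod a) <= tau (Cmod a) / 2) by lra.
    split; [|exact h5].
    apply Rabs_le_between in h5.
    assert (h6 : Rabs (Cmod z - Cmod a) < tau (Cmod a)) by lra.
    lra. }
  split; [intros a ha z hz; apply (hnear a z ha hz)|].
  exists K; split; [exact hK|]; intros [a z] [ha hz]; simpl in ha, hz; simpl.
  destruct (hnear a z ha hz) as [hzb hza]; unfold radial.
  revert ha hzb hza; generalize (Cmod a) (Cmod z); intros s t hs ht' hst.
  (* The moduli differ by at most tau(s)/2 and [tau] is 1-Lipschitz, so tau(s) and tau(t) differ by
     at most tau(s)/2. This gives the hypotheses of [p_comparable] in either order of [s] and
     [t]. *)
  assert (hres : phi1 t <= K * phi1 s /\ phi1 s <= K * phi1 t).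
  { destruct (Rle_lt_dec s t) as [hle' | hlt].
    - assert (h := hlip s t ltac:(lra) ltac:(lra)).
      apply Rabs_le_between in h; apply Rabs_le_between in hst.
      apply hcomp; lra.
    - assert (h := hlip t s ltac:(lra) ltac:(lra)).
      apply Rabs_le_between in h; apply Rabs_le_between in hst.
      apply and_comm, hcomp; generalize (ht s); lra. }
  split; [|apply hres].
  apply Rmult_le_reg_l with K; [exact hK|].
  rewrite <- Rmult_assoc, Rinv_r, Rmult_1_l by lra; apply hres.
Qed.
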